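(* There is a computable language $\mathfrak{L}$ and a fixed computable $\mathfrak{L}$-structure $\mathcal{A}$ such that for every set $X \subseteq \mathbb{N}$, there is a cohesive set $C \subseteq \mathbb{N}$ such that every presentation of the cohesive power $\prod_C \mathcal{A}$ computes $X$.
   Context: Computable languages and structures: A computable language $\mathfrak{L}$ is a countable (finite or infinite) first-order language whose relation, function and constant symbols, together with their arities, are given computably. A presentation (or copy) of a countable $\mathfrak{L}$-structure $\mathcal{M}$ is an isomorphic copy of $\mathcal{M}$ whose domain is a non-empty subset of $\mathbb{N}$. An $\mathfrak{L}$-structure with domain contained in $\mathbb{N}$ is identified with the subset of $\mathbb{N}$ encoding (as an effective join) its domain and the interpretations of all symbols of $\mathfrak{L}$; computability-theoretic terms (computable, computes) applied to such a structure refer to this set. So a structure is computable if it has a non-empty computable domain and uniformly computable interpretations of the symbols. Cohesive sets: $X \subseteq^* Y$ means $X \setminus Y$ is finite. A set $C \subseteq \mathbb{N}$ is cohesive if it is infinite and for every computably enumerable set $W$, either $C \subseteq^* W$ or $C \subseteq^* \mathbb{N} \setminus W$. Cohesive power: Let $\mathcal{A}$ be a computable $\mathfrak{L}$-structure with domain $|\mathcal{A}|$ and let $C$ be cohesive. Let $D$ be the set of partial computable functions $\varphi : \mathbb{N} \to \mathbb{N}$ such that $\varphi(n) \in |\mathcal{A}|$ whenever $\varphi(n)$ is defined, and $C \subseteq^* \mathrm{dom}(\varphi)$. For $\varphi, \psi \in D$ let $\varphi =_C \psi$ mean $C \subseteq^* \{n : \varphi(n) \text{ and } \psi(n) \text{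 are defined and equal}\}$; this is an equivalence relation, and $[\varphi]$ denotes the class of $\varphi$. The cohesive power $\prod_C \mathcal{A}$ is the $\mathfrak{L}$-structure with domain $\{[\varphi] : \varphi \in D\}$ where: for an $m$-ary relation symbol $R$, $R([\varphi_0], \dots, [\varphi_{m-1}])$ holds iff $C \subseteq^* \{n : \varphi_i(n) \text{ is defined for all } i<m \text{ and } R^{\mathcal{A}}(\varphi_0(n), \dots, \varphi_{m-1}(n))\}$; for an $m$-ary function symbol $F$, $F([\varphi_0], \dots, [\varphi_{m-1}]) = [\psi]$ where $\psi(n) \simeq F^{\mathcal{A}}(\varphi_0(n), \dots, \varphi_{m-1}(n))$; and a constant symbol $c$ is interpreted as $[\psi]$ where $\psi(n) = c^{\mathcal{A}}$ for all $n$. *)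

(* Defs.v *)
From mathcomp Require Import all_boot.
From mathcomp Require Import boolp classical_sets functions cardinality.
From Stdlib Require Cantor List.

Set Implicit Arguments.
Unset Strict Implicit.
Unset Printing Implicit Defensive.

Local Open Scope classical_set_scope.

(** * Relative computability *)

Definition npair (x y : nat) : nat := Cantor.to_nat (x, y).
Definition nfst (n : nat) : nat := (Cantor.of_nat n).1.
Definition nsnd (n : nat) : nat := (Cantor.of_nat n).2.

Lemma npairK1 x y : nfst (npair x y) = x.
Proof. by rewrite /nfst /npair Cantor.cancel_of_to. Qed.

Lemma npairK2 x y : nsnd (npair x y) = y.
Proof. by rewrite /nsnd /npair Cantor.cancel_of_to. Qed.

Lemma npair_inj x y x' y' : npair x y = npair x' y' -> x = x' /\ y = y'.
Proof.
move=> e; split; first by rewrite -(npairK1 x y) e npairK1.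
by rewrite -(npairK2 x y) e npairK2.
Qed.

(* Codes for the partial recursive functions relative to an oracle, as unary
   functions; several arguments are passed through the pairing [npair]. *)
Inductive code : Type :=
| Zero
| Succ
| Fst
| Snd
| Oracle
| Pair of code & code
| Comp of code & code
| Prec of code & code
| Min of code.

(* h(a, 0) = F(a) and h(a, n + 1) = G(a, (n, h(a, n))). *)
Fixpoint primrec (F G : nat -> nat -> Prop) (a n v : nat) : Prop :=
  if n is m.+1 then exists2 w, primrec F G a m w & G (npair a (npair m w)) v
  else F a v.

(* [eval O c n y]: with oracle O, the program c on input n halts with output y. *)
Fixpoint eval (O : set nat) (c : code) : nat -> nat -> Prop :=
  match c with
  | Zero => fun n y => y = 0
  | Succ => fun n y => y = n.+1
  | Fst => fun n y => y = nfst n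
  | Snd => fun n y => y = nsnd n
  | Oracle => fun n y => (O n /\ y = 1) \/ (~ O n /\ y = 0)
  | Pair f g => fun n y =>
      exists a b, [/\ eval O f n a, eval O g n b & y = npair a b]
  | Comp f g => fun n y => exists2 z, eval O g n z & eval O f z y
  | Prec f g => fun n y => primrec (eval O f) (eval O g) (nfst n) (nsnd n) y
  | Min f => fun n y => eval O f (npair n y) 0 /\
      forall j, j < y -> exists v, eval O f (npair n j) v.+1
  end.

Lemma eval_functional O c n y z : eval O c n y -> eval O c n z -> y = z.
Proof.
elim: c n y z => [||||| f IHf g IHg | f IHf g IHg | f IHf g IHg | f IHf] n y z
  /=; try by move=> -> ->.
- by move=> [[h ->]|[h ->]] [[k ->]|[k ->]].
- move=> [a [b [fa gb ->]]] [a' [b' [fa' gb' ->]]].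
  by rewrite (IHf _ _ _ fa fa') (IHg _ _ _ gb gb').
- move=> [a ga fa] [b gb fb]; rewrite (IHg _ _ _ ga gb) in fa.
  exact: IHf fa fb.
- elim: (nsnd n) y z => [|m IHm] y z /=; first exact: IHf.
  move=> [w hw gw] [w' hw' gw']; rewrite (IHm _ _ hw hw') in gw.
  exact: IHg gw gw'.
- move=> [fy hy] [fz hz]; case: (ltngtP y z) => // lt.
    by have [v fv] := hz _ lt; have := IHf _ _ _ fy fv.
  by have [v fv] := hy _ lt; have := IHf _ _ _ fz fv.
Qed.

(* X is Turing reducible to O. *)
Definition computes (O X : set nat) : Prop :=
  exists c, forall n, (X n -> eval O c n 1) /\ (~ X n -> eval O c n 0).

Definition computable_set (X : set nat) : Prop := computes set0 X.

(* Partial functions are represented extensionally as [nat -> option nat]. *)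
Definition pfun : Type := nat -> option nat.

Definition partial_computable (phi : pfun) : Prop :=
  exists c, forall n y, phi n = Some y <-> eval set0 c n y.

Definition ce_set (W : set nat) : Prop :=
  exists2 phi : pfun, partial_computable phi & W = [set n | phi n != None].

(** * Computable languages and structures *)

(* A countable language, whose symbols are indexed by natural numbers.  The
   arity functions are meaningful only on the indices of actual symbols. *)
Record language : Type := Language {
  is_rel : pred nat;
  is_fun : pred nat;
  is_const : pred nat;
  rel_ar : nat -> nat;
  fun_ar : nat -> nat;
  rel_ar_gt0 : forall i, is_rel i -> 0 < rel_ar i;
  fun_ar_gt0 : forall i, is_fun i -> 0 < fun_ar i }.

Definition rel_symbol (L : language) : Type := {i : nat | is_rel L i}.
Definition fun_symbol (L : language) : Type := {i : nat | is_fun L i}.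
Definition const_symbol (L : language) : Type := {i : nat | is_const L i}.

Definition rel_arity (L : language) (R : rel_symbol L) : nat :=
  rel_ar L (sval R).
Definition fun_arity (L : language) (F : fun_symbol L) : nat :=
  fun_ar L (sval F).

Definition computable_language (L : language) : Prop :=
  [/\ computable_set [set i | is_rel L i],
      computable_set [set i | is_fun L i],
      computable_set [set i | is_const L i],
      (exists c, forall i, is_rel L i -> eval set0 c i (rel_ar L i)) &
      (exists c, forall i, is_fun L i -> eval set0 c i (fun_ar L i))].

Record interpretation (L : language) (T : Type) : Type := Interpretation {
  rel_int : forall R : rel_symbol L, (rel_arity R).-tuple T -> Prop;
  fun_int : forall F : fun_symbol L, (fun_arity F).-tuple T -> T;
  const_int : const_symbol L -> T }.

Definition isomorphic (L : language) (T U : Type)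
    (M : interpretation L T) (N : interpretation L U) : Prop :=
  exists f : T -> U,
    [/\ bijective f,
        (forall R t, rel_int M (R := R) t <-> rel_int N (R := R) (map_tuple f t)),
        (forall F t, f (fun_int M (F := F) t) = fun_int N (F := F) (map_tuple f t)) &
        (forall c, f (const_int M c) = const_int N c)].

(* L-structures whose domain is a non-empty subset of the natural numbers *)
Record nat_structure (L : language) : Type := NatStructure {
  dom : set nat;
  dom_neq0 : dom !=set0;
  interp :> interpretation L dom }.

(* Injective on the sequences of any given length, which suffices below since
   arities are fixed by the symbols. *)
Definition seq_code (s : seq nat) : nat := foldr npair 0 s.

(* The effective join of the domain and of the interpretations (graphs, for
   function symbols) of all the symbols *)
Definition structure_set (L : language) (A : nat_structure L) : set nat :=
  [set npair 0 x | x in dom A]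
  `|` [set k | exists (R : rel_symbol L) (t : (rel_arity R).-tuple (dom A)),
         rel_int A t /\
         k = npair 1 (npair (sval R) (seq_code (map val t)))]
  `|` [set k | exists (F : fun_symbol L) (t : (fun_arity F).-tuple (dom A)),
         k = npair 2 (npair (sval F)
               (npair (seq_code (map val t)) (val (fun_int A t))))]
  `|` [set k | exists c : const_symbol L,
         k = npair 3 (npair (sval c) (val (const_int A c)))].

Definition computable_structure (L : language) (A : nat_structure L) : Prop :=
  computable_set (structure_set A).

Definition presentation (L : language) (T : Type) (M : interpretation L T)
    (B : nat_structure L) : Prop :=
  isomorphic B M.

(** * Cohesive sets *)

Definition almost_subset (X Y : set nat) : Prop := finite_set (X `\` Y).

Definition cohesive (C : set nat) : Prop :=
  infinite_set C /\
  forall W, ce_set W -> almost_subset C W \/ almost_subset C (~` W).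

(** * Cohesive powers *)

(* [Some v] with v satisfying P if there is one, and [None] otherwise *)
Definition some_such (P : set nat) : option nat :=
  if pselect (exists v, P v) is left h then Some (sval (cid h)) else None.

Lemma some_suchP (P : set nat) :
  (forall x y, P x -> P y -> x = y) -> forall y, some_such P = Some y <-> P y.
Proof.
move=> Pu y; rewrite /some_such; case: pselect => [h|h]; last first.
  by split=> // Py; case: h; exists y.
case: cid => x /= Px; split=> [[<-]//|Py]; congr Some; exact: Pu.
Qed.

Lemma almost_subsetW (X Y Z : set nat) :
  Y `<=` Z -> almost_subset X Y -> almost_subset X Z.
Proof.
by move=> YZ; apply: sub_finite_set => n [Xn nZ]; split=> // /YZ.
Qed.

Lemma almost_subsetI (X Y Z : set nat) :
  almost_subset X Y -> almost_subset X Z -> almost_subset X (Y `&` Z).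
Proof. by move=> XY XZ; rewrite /almost_subset setDIr finite_setU. Qed.

Lemma almost_subset_bigI (X : set nat) m (Y : 'I_m -> set nat) :
  (forall i, almost_subset X (Y i)) ->
  almost_subset X [set n | forall i, Y i n].
Proof.
elim: m Y => [|m IHm] Y XY.
  have -> : [set n | forall i, Y i n] = setT by apply/seteqP; split=> // n _ [].
  by rewrite /almost_subset setDT.
have h := almost_subsetI (XY ord0) (IHm (Y \o lift ord0) (fun i => XY _)).
apply: almost_subsetW h => n [Y0 Yl] i /=.
by case: (unliftP ord0 i) => [j ->|->//]; apply: Yl.
Qed.

Section CohesivePower.
Variables (L : language) (A : nat_structure L).
Hypothesis hA : computable_structure A.
Variable C : set nat.

Definition power_fun : set pfun := [set phi |
  [/\ partial_computable phi,
      (forall n y, phi n = Some y -> dom A y) &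
      almost_subset C [set n | phi n != None]]].

Definition power_eq (phi psi : pfun) : Prop :=
  almost_subset C [set n | exists y, phi n = Some y /\ psi n = Some y].

Definition power_class (phi : pfun) : set pfun :=
  [set psi | power_fun psi /\ power_eq phi psi].

Definition power_dom : set (set pfun) := power_class @` power_fun.

Lemma power_eq_refl phi : power_fun phi -> power_eq phi phi.
Proof.
case=> _ _; apply: almost_subsetW => n /=.
by case: (phi n) => // y _; exists y.
Qed.

Lemma power_eq_sym phi psi : power_eq phi psi -> power_eq psi phi.
Proof. by apply: almost_subsetW => n [y [h k]]; exists y. Qed.

Lemma power_eq_trans phi psi chi :
  power_eq phi psi -> power_eq psi chi -> power_eq phi chi.
Proof.
move=> h k; apply: almost_subsetW (almost_subsetI h k) => n [[y [h1 h2]]].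
by move=> [z [k1 k2]]; exists y; rewrite k2 -k1 h2.
Qed.

Lemma power_class_eq phi psi : power_fun phi -> power_fun psi ->
  power_class phi = power_class psi <-> power_eq phi psi.
Proof.
move=> hphi hpsi; split=> [e|e].
  have : power_class psi psi by split=> //; apply: power_eq_refl.
  by rewrite -e => -[].
apply/seteqP; split=> chi [hchi k]; split=> //.
  by apply: power_eq_trans k; apply: power_eq_sym.
exact: power_eq_trans k.
Qed.

Definition to_power (phi : pfun) (h : power_fun phi) : power_dom :=
  exist _ (power_class phi) (mem_set (ex_intro2 _ _ phi h erefl)).

Definition repr_subproof (K : power_dom) :
  exists phi, power_fun phi /\ power_class phi = val K.
Proof. by have [phi h e] := set_mem (valP K); exists phi. Qed.

Definition repr (K : power_dom) : pfun := sval (cid (repr_subproof K)).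

Lemma repr_fun K : power_fun (repr K).
Proof. by rewrite /repr; case: cid => ? []. Qed.

Lemma reprK K : to_power (repr_fun K) = K.
Proof. by apply: val_inj; rewrite /= /repr; case: cid => ? []. Qed.

Lemma to_powerP phi psi (h : power_fun phi) (k : power_fun psi) :
  to_power h = to_power k <-> power_eq phi psi.
Proof.
rewrite -power_class_eq//; split=> [/(congr1 val)//|e]; exact: val_inj.
Qed.

Lemma repr_to_power phi (h : power_fun phi) : power_eq (repr (to_power h)) phi.
Proof. by apply/(to_powerP (repr_fun _) h); rewrite reprK. Qed.

(* The values at n of the partial functions phi_i are all defined, and form
   the tuple t. *)
Definition values m (phi : 'I_m -> pfun) (n : nat) (t : m.-tuple (dom A)) :
  Prop := forall i, phi i n = Some (val (tnth t i)).

Lemma values_uniq m (phi : 'I_m -> pfun) n t u :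
  values phi n t -> values phi n u -> t = u.
Proof.
move=> ht hu; apply: eq_from_tnth => i; apply: val_inj.
by have := hu i; rewrite (ht i) => -[].
Qed.

Lemma values_ex m (phi : 'I_m -> pfun) n :
  (forall i, power_fun (phi i)) -> (forall i, phi i n != None) ->
  exists t, values phi n t.
Proof.
move=> h d.
have /choice[y hy] : forall i, exists y : dom A, phi i n = Some (val y).
  move=> i; have := d i; case e : (phi i n) => [y|//] _.
  have [_ hd _] := h i.
  by exists (exist _ y (mem_set (hd _ _ e))).
by exists [tuple y i | i < m] => i; rewrite tnth_mktuple.
Qed.

Definition power_rel (R : rel_symbol L) (t : (rel_arity R).-tuple power_dom) :
    Prop :=
  almost_subset C [set n |
    exists2 a, values (fun i => repr (tnth t i)) n a & rel_int A a].

(* psi(n) = F(phi_0(n), ..., phi_{m-1}(n)) *)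
Definition power_app (F : fun_symbol L) (phi : 'I_(fun_arity F) -> pfun) : pfun :=
  fun n => some_such
    [set y | exists2 a, values phi n a & y = val (fun_int A a)].

Lemma power_appP F (phi : 'I_(fun_arity F) -> pfun) n y :
  power_app phi n = Some y <->
  exists2 a, values phi n a & y = val (fun_int A a).
Proof.
apply: some_suchP => {}y z [a ha ->] [b hb ->].
by rewrite (values_uniq ha hb).
Qed.

Lemma seq_code_inj (s t : seq nat) :
  size s = size t -> seq_code s = seq_code t -> s = t.
Proof.
elim: s t => [|x s IHs] [|y t] //= [es] /npair_inj[-> /IHs ->//].
Qed.

Lemma structure_set_fun (F : fun_symbol L) (t : (fun_arity F).-tuple (dom A)) y :
  structure_set A (npair 2 (npair (sval F) (npair (seq_code (map val t)) y)))
  <-> y = val (fun_int A t).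
Proof.
split=> [|->]; last by left; right; exists F, t.
move=> [[[[x _ /npair_inj[//]]|[R [u [_ /npair_inj[//]]]]]|]|]; last first.
  by move=> [c /npair_inj[//]].
move=> [G [u /npair_inj[_ /npair_inj[]]]].
move=> e; have {e} e : F = G by apply: val_inj.
subst G => /npair_inj[e ->].
suff -> : t = u by [].
apply: val_inj; apply: (inj_map val_inj).
by apply: seq_code_inj e; rewrite !size_map !size_tuple.
Qed.

Fixpoint const_code (k : nat) : code :=
  if k is k'.+1 then Comp Succ (const_code k') else Zero.

Lemma const_codeP O k n y : eval O (const_code k) n y <-> y = k.
Proof.
elim: k y => [|k IHk] y //=; split=> [[z /IHk -> ->//]|->].
by exists k => //; apply/IHk.
Qed.

(* codes 1 if x = 0, and 0 otherwise *)
Definition not_code : code :=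
  Comp (Prec (const_code 1) Zero) (Pair Zero (Pair Fst Snd)).

Lemma npair_surj n : npair (nfst n) (nsnd n) = n.
Proof.
rewrite /npair /nfst /nsnd -[in RHS](Cantor.cancel_to_of n).
by case: (Cantor.of_nat n).
Qed.

Lemma not_codeP O n y : eval O not_code n y <-> y = (n == 0).
Proof.
split=> [[_ [_ [_ [-> [_ [_ [-> -> ->]]] ->]]]]|->].
  cbn [eval]; rewrite npairK1 npairK2 npair_surj.
  by case: n => [|n] /=; [case=> ? -> ->|case].
exists (npair 0 n).
  by exists 0, n; split=> //; exists (nfst n), (nsnd n); rewrite npair_surj.
have h : forall m, eval O (Prec (const_code 1) Zero) (npair 0 m) (m == 0).
  elim=> [|m]; cbn [eval]; rewrite !npairK1 !npairK2 /=; first by exists 0.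
  by move=> IHm; exists (m == 0).
exact: h.
Qed.

Lemma seq_code_computable (s : seq pfun) :
  (forall phi, List.In phi s -> partial_computable phi) ->
  exists c, forall n k, eval set0 c n k <->
    exists v : seq nat, map (fun phi => phi n) s = map Some v /\ k = seq_code v.
Proof.
elim: s => [|phi s IHs] hs.
  exists Zero => n k; split=> /= [->|[]]; first by exists [::].
  by case=> [[_ ->]|? ? []].
have [d hd] := hs phi (or_introl erefl).
have [c hc] := IHs (fun psi h => hs psi (or_intror h)).
exists (Pair d c) => n k; split=> /=.
  move=> [a [b [/hd ha /hc[v [hv ->]] ->]]].
  by exists (a :: v); rewrite /= ha hv.
case=> -[[]//|a v] [[ha hv] ->].
by exists a, (seq_code v); split=> //; [apply/hd|apply/hc; exists v].
Qed.

Lemma power_app_fun F (phi : 'I_(fun_arity F) -> pfun) :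
  (forall i, power_fun (phi i)) -> power_fun (power_app phi).
Proof.
move=> h; split; last 2 first.
- by move=> n y /power_appP[a _ ->]; apply: set_mem (valP _).
- have hdef : forall i, almost_subset C [set n | phi i n != None].
    by move=> i; have [] := h i.
  apply: almost_subsetW (almost_subset_bigI hdef) => n /= d.
  have [a ha] := values_ex h d.
  suff /= -> : power_app phi n = Some (val (fun_int A a)) by [].
  by apply/power_appP; exists a.
pose s := [seq phi i | i <- enum 'I_(fun_arity F)].
have hs : forall f, List.In f s -> partial_computable f.
  move=> f; rewrite /s; elim: (enum _) => //= i r IHr [<-|/IHr//].
  by have [] := h i.
have [c hc] := seq_code_computable hs.
have hv n (v : seq nat) : map (fun f => f n) s = map Some v ->
    exists2 a, values phi n a & v = map val a.
  move=> e.
  have d : forall i, phi i n != None.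
    move=> i; have sv : size v = fun_arity F.
      by rewrite -(size_map Some) -e /s 2!size_map size_enum_ord.
    have := congr1 (fun r => nth None r i) e.
    rewrite /s -map_comp (nth_map i); last by rewrite size_enum_ord.
    rewrite nth_ord_enum /= => ->.
    by rewrite (nth_map 0) ?sv.
  have [a ha] := values_ex h d; exists a => //.
  apply: (@inj_map _ _ Some) => [x y []//|].
  rewrite -e -[in RHS](map_tnth_enum a) /s -!map_comp.
  by apply: eq_map => i /=; rewrite (ha i).
have hv' n a : values phi n a -> map (fun f => f n) s = map Some (map val a).
  move=> ha; rewrite -[in RHS](map_tnth_enum a) /s -!map_comp.
  by apply: eq_map => i /=; rewrite (ha i).
have [x hx] := hA.
pose q := Pair (const_code 2) (Pair (const_code (sval F)) (Pair (Comp c Fst) Snd)).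
have hq n y a : values phi n a -> forall k, eval set0 (Comp not_code (Comp x q))
    (npair n y) k <-> k = (y != val (fun_int A a)).
  move=> ha.
  pose z := npair 2 (npair (sval F) (npair (seq_code (map val a)) y)).
  have hz : eval set0 q (npair n y) z.
    exists 2; eexists; split; [exact/const_codeP| |reflexivity].
    eexists; eexists; split; [exact/const_codeP| |reflexivity].
    exists (seq_code (map val a)), y; split; rewrite /= ?npairK2//.
    by exists n; rewrite ?npairK1//; apply/hc; exists (map val a); rewrite (hv' _ _ ha).
  have hxz : eval set0 x z (y == val (fun_int A a)).
    have [h1 h0] := hx z; case: eqP => e; [apply: h1|apply: h0].
      exact/structure_set_fun.
    by move/structure_set_fun.
  have hk : eval set0 (Comp not_code (Comp x q)) (npair n y)
      (y != val (fun_int A a)).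
    exists (y == val (fun_int A a)); first by exists z.
    by apply/not_codeP; case: eqP.
  by move=> k; split=> [hk'|->//]; apply: eval_functional hk' hk.
have hq' n y k : eval set0 (Comp not_code (Comp x q)) (npair n y) k ->
    exists a, values phi n a.
  move=> [? [? [? [? [_ h1 _]]] _] _].
  have [? [? [_ [t [? [[? -> hct] _ _]]] _]]] := h1.
  move: hct; rewrite npairK1 => /hc[v [/hv[a ha _] _]]; by exists a.
exists (Min (Comp not_code (Comp x q))) => n y; split.
  move=> /power_appP[a ha ->]; split.
    by apply/(hq _ _ _ ha); rewrite eqxx.
  move=> j lt; exists 0; apply/(hq _ _ _ ha).
  by rewrite neq_ltn lt.
move=> [h0 _]; apply/power_appP; have [a ha] := hq' _ _ _ h0; exists a => //.
by move/(hq _ _ _ ha): h0; case: eqP.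
Qed.

Definition power_func (F : fun_symbol L) (t : (fun_arity F).-tuple power_dom) :
    power_dom :=
  to_power (power_app_fun (fun i => repr_fun (tnth t i))).

Lemma power_const_fun (c : const_symbol L) :
  power_fun (fun=> Some (val (const_int A c))).
Proof.
split.
- exists (const_code (val (const_int A c))) => n y; split.
    by move=> [<-]; apply/const_codeP.
  by move/const_codeP ->.
- by move=> n y [<-]; apply: set_mem (valP _).
- by rewrite /almost_subset (_ : [set _ | _] = setT) ?setDT//; apply/seteqP.
Qed.

Definition cohesive_power : interpretation L power_dom :=
  {| rel_int := power_rel;
     fun_int := power_func;
     const_int := fun c => to_power (power_const_fun c) |}.

Lemma values_congr m (phi psi : 'I_m -> pfun) n a :
  (forall i, exists y, phi i n = Some y /\ psi i n = Some y) ->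
  values phi n a -> values psi n a.
Proof.
by move=> e ha i; have [y []] := e i; rewrite (ha i) => -[<-].
Qed.

(* The interpretations do not depend on the representatives chosen by [repr]. *)
Lemma cohesive_power_relE (R : rel_symbol L) (phi : 'I_(rel_arity R) -> pfun)
    (h : forall i, power_fun (phi i)) :
  rel_int cohesive_power [tuple to_power (h i) | i < rel_arity R] <->
  almost_subset C [set n | exists2 a, values phi n a & rel_int A a].
Proof.
have e i : power_eq (repr (tnth [tuple to_power (h i) | i < rel_arity R] i))
    (phi i).
  by rewrite tnth_mktuple; apply: repr_to_power.
split=> k; have := almost_subsetI k (almost_subset_bigI e);
    apply: almost_subsetW => n [[a ha Ra] en]; exists a => //.
  exact: values_congr ha.
by apply: values_congr ha => i; have [y []] := en i; exists y.
Qed.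

Lemma cohesive_power_funE (F : fun_symbol L) (phi : 'I_(fun_arity F) -> pfun)
    (h : forall i, power_fun (phi i)) :
  fun_int cohesive_power [tuple to_power (h i) | i < fun_arity F] =
  to_power (power_app_fun h).
Proof.
apply/to_powerP.
have e i : power_eq (repr (tnth [tuple to_power (h i) | i < fun_arity F] i))
    (phi i).
  by rewrite tnth_mktuple; apply: repr_to_power.
have [_ _ d] := power_app_fun h.
apply: almost_subsetW (almost_subsetI d (almost_subset_bigI e)) => n [/=].
case E : (power_app phi n) => [y|//] _ en; exists y; split=> //.
have [a ha ->] := (power_appP phi n y).1 E.
apply/power_appP; exists a => //.
by apply: values_congr ha => i; have [z []] := en i; exists z.
Qed.

End CohesivePower.

(* Main.v *)
Require Import Defs.
From mathcomp Require Import all_boot.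
From mathcomp Require Import boolp classical_sets functions cardinality.
From Stdlib Require Cantor.

(** The structure has domain [nat] and one unary relation [R_i] for each [i].
    A number is read as a list through iterated pairing, and [R_i x] says that
    the [i]-th entry of [x] is nonzero.  In a cohesive power, the element
    [[id]] satisfies [R_i] exactly when almost all members of [C] satisfy
    [R_i].  So it suffices that, for each [i], almost every member of [C] has
    the truth value of [X i] as its [i]-th entry: then [X] is the set of the
    [i] with [R_i [id]], and a presentation answers these questions after one
    fixes the number that stands for [[id]] in it.

    Such a [C] exists because cohesive sets occur inside every infinite set
    [E] ([cohesive_subset]): one refines [E] successively by each c.e. set or
    by its complement, keeping it infinite, and diagonalizes.  This is applied
    to the set [E] of the numbers [prefix_code X k], whose first [k] entries
    are the first [k] values of [X]; being almost contained in each condition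
    on a single entry passes from [E] to its subsets. *)

Set Implicit Arguments.
Unset Strict Implicit.
Unset Printing Implicit Defensive.

Local Open Scope classical_set_scope.

(** * Cohesive subsets of infinite sets of natural numbers *)

Lemma infinite_unbounded (D : set nat) k :
  infinite_set D -> exists2 x, D x & k <= x.
Proof.
move=> Dinf; apply: contrapT => h; apply: Dinf.
apply: (@sub_finite_set _ _ `I_k) (finite_II k) => x Dx /=.
by rewrite ltnNge; apply/negP => kx; apply: h; exists x.
Qed.

Lemma infinite_range_ge (c : nat -> nat) :
  (forall k, k <= c k) -> infinite_set (range c).
Proof.
move=> cge /finite_seqP[s es].
pose k := (\max_(x <- s) x).+1.
have : range c (c k) by exists k.
rewrite es /= => cks.
have := @leq_bigmax_seq _ s xpredT id _ cks isT.
by move=> /(leq_trans (cge k)); rewrite ltnn.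
Qed.

Lemma infinite_setI_or_setD (D W : set nat) :
  infinite_set D -> ~ infinite_set (D `&` W) -> infinite_set (D `\` W).
Proof.
move=> Dinf /contrapT DW DnW; apply: Dinf.
by rewrite -(setUIDK D W) finite_setU.
Qed.

Section Refinement.
Variables (E : set nat) (W : nat -> set nat).

Fixpoint refine (i : nat) : set nat :=
  if i is j.+1 then
    if `[< infinite_set (refine j `&` W j) >] then refine j `&` W j
    else refine j `\` W j
  else E.

Lemma refine_infinite i : infinite_set E -> infinite_set (refine i).
Proof.
move=> Einf; elim: i => //= i IHi; case: asboolP => //.
exact: infinite_setI_or_setD.
Qed.

Lemma refine_sub i j : i <= j -> refine j `<=` refine i.
Proof.
move=> /subnK <-; elim: (j - i) => //= m IHm.
by case: asboolP => _; apply: subset_trans IHm => x [].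
Qed.

Lemma refine_decides i : refine i.+1 `<=` W i \/ refine i.+1 `<=` ~` W i.
Proof. by move=> /=; case: asboolP => _; [left|right] => x []. Qed.

End Refinement.

(** The refinements decrease, so choosing the [k]-th element in the [k]-th
    refinement leaves at most [i] elements outside the [i]-th one, for every
    [i].  Choosing it at least [k] keeps the chosen set infinite. *)
Lemma infinite_subset_deciding (E : set nat) (W : nat -> set nat) :
  infinite_set E -> exists C, [/\ infinite_set C, C `<=` E &
    forall i, almost_subset C (W i) \/ almost_subset C (~` W i)].
Proof.
move=> Einf.
have /choice[c hc] k : exists x, refine E W k x /\ k <= x.
  have [x Dx kx] := infinite_unbounded k (@refine_infinite E W k Einf).
  by exists x.
have Calmost i : almost_subset (range c) (refine E W i).
  apply: (@sub_finite_set _ _ (c @` `I_i)); last exact/finite_image/finite_II.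
  move=> _ [[k _ <-] nD]; exists k => //=; rewrite ltnNge; apply/negP => ik.
  by apply: nD; apply: refine_sub ik _ _; have [] := hc k.
exists (range c); split.
- by apply: infinite_range_ge => k; have [] := hc k.
- by move=> _ [k _ <-]; apply: (@refine_sub E W 0 k) => //; have [] := hc k.
- move=> i; have [h|h] := refine_decides E W i; [left|right];
    exact: almost_subsetW h (Calmost _).
Qed.

(** A numbering of the programs, which arranges the c.e. sets in a sequence. *)
Fixpoint encode (c : code) : nat :=
  match c with
  | Zero => npair 0 0
  | Succ => npair 1 0
  | Fst => npair 2 0
  | Snd => npair 3 0
  | Oracle => npair 4 0
  | Pair f g => npair 5 (npair (encode f) (encode g))
  | Comp f g => npair 6 (npair (encode f) (encode g))
  | Prec f g => npair 7 (npair (encode f) (encode g))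
  | Min f => npair 8 (encode f)
  end.

Lemma encode_inj : injective encode.
Proof.
elim=> [||||| f IHf g IHg | f IHf g IHg | f IHf g IHg | f IHf]
  [||||| f' g' | f' g' | f' g' | f'] //= /npair_inj[] //.
- by move=> _ /npair_inj[/IHf -> /IHg ->].
- by move=> _ /npair_inj[/IHf -> /IHg ->].
- by move=> _ /npair_inj[/IHf -> /IHg ->].
- by move=> _ /IHf ->.
Qed.

Lemma cohesive_subset (E : set nat) :
  infinite_set E -> exists2 C, cohesive C & C `<=` E.
Proof.
move=> Einf.
pose W i := [set n | exists c y, encode c = i /\ eval set0 c n y].
have [C [Cinf CE CW]] := infinite_subset_deciding W Einf.
exists C => //; split=> // V [phi [c hc] ->].
suff -> : [set n | phi n != None] = W (encode c) by [].
apply/seteqP; split=> n /=.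
  by case e : (phi n) => [y|//] _; exists c, y; split=> //; apply/hc.
by move=> [d [y [/encode_inj -> /hc ->]]].
Qed.

(** * Programs *)

Definition id_code : code := Pair Fst Snd.

Lemma id_codeP O n y : eval O id_code n y <-> y = n.
Proof.
split=> [[_ [_ [-> -> ->]]]|->]; first exact: npair_surj.
by exists (nfst n), (nsnd n); split=> //; rewrite npair_surj.
Qed.

Definition computes_fun (O : set nat) (c : code) (f : nat -> nat) : Prop :=
  forall n, eval O c n (f n).

Section Programs.
Variable O : set nat.

Lemma computes_fun_ext c f g :
  f =1 g -> computes_fun O c f -> computes_fun O c g.
Proof. by move=> fg hc n; rewrite -fg. Qed.

Lemma computes_id : computes_fun O id_code id.
Proof. by move=> n; exists (nfst n), (nsnd n); rewrite npair_surj. Qed.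

Lemma computes_const k : computes_fun O (const_code k) (fun=> k).
Proof. by move=> n; apply/const_codeP. Qed.

Lemma computes_pair c d f g : computes_fun O c f -> computes_fun O d g ->
  computes_fun O (Pair c d) (fun n => npair (f n) (g n)).
Proof. by move=> hc hd n; exists (f n), (g n). Qed.

Lemma computes_comp c d f g : computes_fun O c f -> computes_fun O d g ->
  computes_fun O (Comp c d) (f \o g).
Proof. by move=> hc hd n; exists (g n). Qed.

Lemma computes_prec c d f g : computes_fun O c f -> computes_fun O d g ->
  computes_fun O (Prec c d) (fun n =>
    nat_rect (fun=> nat) (f (nfst n))
      (fun m w => g (npair (nfst n) (npair m w))) (nsnd n)).
Proof.
move=> hc hd n; cbn [eval].
by elim: (nsnd n) => [|m IHm] /=; [exact: hc|eexists; [exact: IHm|exact: hd]].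
Qed.

Definition pred_code : code :=
  Comp (Prec Zero (Comp Fst Snd)) (Pair Zero id_code).

Lemma computes_pred : computes_fun O pred_code predn.
Proof.
apply: computes_fun_ext (computes_comp (computes_prec (f := fun=> 0)
  (g := nfst \o nsnd) _ _) (computes_pair (f := fun=> 0) _ computes_id)) => //.
  by move=> n; rewrite /= npairK2; case: n => //= m; rewrite npairK2 npairK1.
exact: computes_comp.
Qed.

(** A recursion whose step forgets the previous value is a case distinction
    between zero and successors. *)
Definition if_code (t c d : code) : code :=
  Comp (Prec d (Comp c Fst)) (Pair id_code t).

Lemma computes_if t c d p f g :
  computes_fun O t p -> computes_fun O c f -> computes_fun O d g ->
  computes_fun O (if_code t c d) (fun n => if p n != 0 then f n else g n).
Proof.
move=> ht hc hd.
apply: computes_fun_ext (computes_comp (computes_prec hd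
  (computes_comp (g := nfst) hc _)) (computes_pair computes_id ht)) => // n.
by rewrite /= npairK1 npairK2; case: (p n) => //= m; rewrite npairK1.
Qed.

Definition iter_code (c : code) : code := Prec id_code (Comp c (Comp Snd Snd)).

Lemma computes_iter c f : computes_fun O c f ->
  computes_fun O (iter_code c) (fun n => iter (nsnd n) f (nfst n)).
Proof.
move=> hc; apply: computes_fun_ext (computes_prec computes_id
  (computes_comp (g := nsnd \o nsnd) hc _)).
  move=> n /=; elim: (nsnd n) => //= m IHm.
  by rewrite !npairK2 IHm.
exact: computes_comp.
Qed.

End Programs.

(** * The structure *)

Definition entry (i x : nat) : nat := nfst (iter i nsnd x).

Definition unary_language : language :=
  @Language predT pred0 pred0 (fun=> 1) (fun=> 1)
    (fun _ _ => isT) (fun _ _ => isT).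

Lemma computable_unary_language : computable_language unary_language.
Proof.
split.
- by exists (const_code 1) => n; split=> [_|/(_ isT)//]; apply/const_codeP.
- by exists (const_code 0) => n; split=> [//|_]; apply/const_codeP.
- by exists (const_code 0) => n; split=> [//|_]; apply/const_codeP.
- by exists (const_code 1) => n _; apply/const_codeP.
- by exists (const_code 1) => n _; apply/const_codeP.
Qed.

Definition entry_structure : nat_structure unary_language :=
  @NatStructure unary_language setT (ex_intro _ 0 I)
    {| rel_int := fun (R : rel_symbol unary_language)
         (t : (rel_arity R).-tuple [set: nat]) =>
         entry (sval R) (val (thead t)) <> 0;
       fun_int := fun F => False_rect _ (Bool.diff_false_true (valP F));
       const_int := fun c => False_rect _ (Bool.diff_false_true (valP c)) |}.

(** The effective join contains every number tagged 0, for the domain, and the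
    numbers [npair 1 (npair i (npair x 0))] with [R_i x]: the last 0 ends the
    coded list of the arguments of [R_i], whose only entry is [x]. *)
Definition entry_structure_char (k : nat) : nat :=
  let r := nsnd k in
  if nfst k != 0 then
    if (nfst k).-1 != 0 then 0 else
    if nsnd (nsnd r) != 0 then 0 else
    if entry (nfst r) (nfst (nsnd r)) != 0 then 1 else 0
  else 1.

Lemma computes_entry_structure_char :
  exists c, computes_fun set0 c entry_structure_char.
Proof.
pose snd2 := Comp Snd Snd.
exists (if_code Fst (if_code (Comp pred_code Fst) Zero
  (if_code (Comp Snd snd2) Zero
    (if_code (Comp Fst (Comp (iter_code Snd)
               (Pair (Comp Fst snd2) (Comp Fst Snd))))
       (const_code 1) Zero))) (const_code 1)).
have hsnd2 : computes_fun set0 snd2 (nsnd \o nsnd) by apply: computes_comp.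
apply: computes_if => //; last exact: computes_const.
apply: computes_if => //.
  by apply: computes_comp => //; apply: computes_pred.
apply: computes_if => //; first by apply: (computes_comp (f := nsnd)) hsnd2.
apply: computes_if => //; last exact: computes_const.
have hp := computes_pair (computes_comp (f := nfst) (c := Fst) _ hsnd2)
  (computes_comp (O := set0) (f := nfst) (g := nsnd) (c := Fst) (d := Snd) _ _).
apply: computes_fun_ext (computes_comp (f := nfst) _
  (computes_comp (computes_iter (f := nsnd) _) (hp _ _ _))) => // k.
by rewrite /entry /= npairK1 npairK2.
Qed.

Lemma structure_set_rel (L : language) (A : nat_structure L) (R : rel_symbol L)
    (t : (rel_arity R).-tuple (dom A)) :
  structure_set A (npair 1 (npair (sval R) (seq_code (map val t))))
  <-> rel_int A t.
Proof.
split=> [|Rt]; last by left; left; right; exists R, t.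
move=> [[[[x _ /npair_inj[//]]|[S [u [Su]]]]|]|]; last first.
- by move=> [c /npair_inj[//]].
- by move=> [F [u /npair_inj[//]]].
move=> /npair_inj[_ /npair_inj[e]]; have {}e : R = S by apply: val_inj.
subst S => e; suff -> : t = u by [].
apply: val_inj; apply: (inj_map val_inj).
by apply: seq_code_inj e; rewrite !size_map !size_tuple.
Qed.

Lemma computable_entry_structure : computable_structure entry_structure.
Proof.
have [c hc] := computes_entry_structure_char.
suff h k : structure_set entry_structure k <-> entry_structure_char k = 1.
  exists c => k; split=> [/h <-//|nk].
  suff <- : entry_structure_char k = 0 by [].
  by move: nk; rewrite h /entry_structure_char; do 4?case: ifP.
split.
  move=> [[[[x _ <-]|[R [t [Rt ->]]]]|[[F //]]]|[[a //]]].
    by rewrite /entry_structure_char npairK1.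
  case: (tupleP t) Rt => x u; rewrite (tuple0 u) /= theadE => /eqP Rx.
  by rewrite /entry_structure_char !(npairK1, npairK2) /= Rx.
rewrite /entry_structure_char.
case: eqP => [k0 _|/eqP k0] /=.
  by left; left; left; exists (nsnd k) => //; rewrite -k0 npair_surj.
case: eqP => // k1; case: eqP => // r0; case: eqP => // Rx _.
left; left; right.
pose x : [set: nat] := exist _ (nfst (nsnd (nsnd k))) (mem_set I).
exists (exist _ (nfst (nsnd k)) isT), [tuple x]; split=> //=.
have <- : nfst k = 1 by case: (nfst k) k0 k1 => // -[].
by rewrite -[X in npair (nfst (nsnd (nsnd k))) X]r0 !npair_surj.
Qed.

(** * Coding a set into a cohesive power *)

Definition prefix_code (X : set nat) (k : nat) : nat :=
  foldr npair k [seq nat_of_bool `[< X i >] | i <- iota 0 k].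

Lemma entry_foldr s z i : i < size s -> entry i (foldr npair z s) = nth 0 s i.
Proof.
rewrite /entry; elim: s i => // x s IHs [|i] /= lt; first by rewrite npairK1.
by rewrite -iterS iterSr npairK2 IHs.
Qed.

Lemma entry_prefix_code X k i : i < k ->
  entry i (prefix_code X k) = `[< X i >].
Proof.
move=> ik; rewrite entry_foldr ?size_map ?size_iota //.
by rewrite (nth_map 0) ?size_iota // nth_iota.
Qed.

(** The innermost component of the code is [k], and pairing never decreases its
    second argument; this makes the set of the prefix codes infinite. *)
Lemma prefix_code_ge X k : k <= prefix_code X k.
Proof.
rewrite /prefix_code; elim: [seq _ | _ <- _] => //= x s /leq_trans; apply.
have /leP := Cantor.to_nat_non_decreasing x (foldr npair k s).
by rewrite plusE => /(leq_trans (leq_addr _ _)).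
Qed.

Lemma cohesive_entries (X : set nat) : exists2 C, cohesive C &
  forall i, almost_subset C [set x | entry i x = `[< X i >]].
Proof.
have [C Ccoh CE] := cohesive_subset (infinite_range_ge (prefix_code_ge X)).
exists C => // i; apply: (@sub_finite_set _ _ (prefix_code X @` `I_i.+1)).
  move=> x [/CE[k _ <-] nX]; exists k => //=; rewrite ltnS leqNgt; apply/negP.
  by move=> ik; apply: nX; apply: entry_prefix_code.
exact/finite_image/finite_II.
Qed.

Lemma power_fun_id C : power_fun entry_structure C (fun n => Some n).
Proof.
split=> //; last by apply: (@sub_finite_set _ _ set0) => // x [_ []].
by exists id_code => n y; rewrite id_codeP; split=> [[]|->].
Qed.

Definition rel_index (i : nat) : rel_symbol unary_language := exist _ i isT.

(** Almost all members of [C] have the truth value of [X i] as their [i]-th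
    entry.  If this is 0, then [R_i] cannot hold almost everywhere on [C] too,
    because [C] is infinite. *)
Lemma power_rel_id (X C : set nat) : infinite_set C ->
  (forall i, almost_subset C [set x | entry i x = `[< X i >]]) ->
  forall i, X i <-> rel_int (cohesive_power computable_entry_structure C)
    (R := rel_index i) [tuple of nseq 1 (to_power (power_fun_id C))].
Proof.
move=> Cinf CX i.
have -> : [tuple of nseq 1 (to_power (power_fun_id C))] =
    [tuple to_power (power_fun_id C) | _ < rel_arity (rel_index i)].
  by apply: eq_from_tnth => j; rewrite tnth_mktuple tnth_nseq.
rewrite (@cohesive_power_relE _ _ _ C (rel_index i)).
have hval n (a : 1.-tuple [set: nat]) :
    values (A := entry_structure) (fun=> Some) n a -> val (thead a) = n.
  by move=> /(_ ord0)[].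
split=> [Xi|h].
  apply: almost_subsetW (CX i) => n /= en.
  exists [tuple (exist _ n (mem_set I) : [set: nat])].
    by move=> j; rewrite ord1.
  by rewrite /= en asboolT.
apply: contrapT => nXi; apply: Cinf.
suff : almost_subset C set0 by rewrite /almost_subset setD0.
apply: almost_subsetW (almost_subsetI (CX i) h) => n [/= en [a /hval an]].
by rewrite /= an en asboolF.
Qed.

Theorem proposition3p1 :
  exists (L : language) (A : nat_structure L) (hA : computable_structure A),
    computable_language L /\
    forall X : set nat, exists C : set nat,
      cohesive C /\
      forall B : nat_structure L,
        presentation (cohesive_power hA C) B -> computes (structure_set B) X.
Proof.
exists unary_language, entry_structure, computable_entry_structure.
split; first exact: computable_unary_language.
move=> X; have [C Ccoh CX] := cohesive_entries X.
exists C; split=> // B [f [[g fK gK] frel _ _]].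
(* The number standing for [[id]]; it enters the program as a constant. *)
pose b := g (to_power (power_fun_id C)).
have hX i : X i <->
    structure_set B (npair 1 (npair i (seq_code [:: val b]))).
  apply: iff_trans (power_rel_id Ccoh.1 CX i) _; apply: iff_sym.
  apply: iff_trans (structure_set_rel (R := rel_index i) [tuple b]) _.
  rewrite frel.
  suff -> : map_tuple f [tuple b] = 
    [tuple of nseq 1 (to_power (power_fun_id C))] by [].
  by apply: val_inj; rewrite /= gK.
pose q := Pair (const_code 1) (Pair id_code (const_code (seq_code [:: val b]))).
have hq : computes_fun (structure_set B) q
    (fun i => npair 1 (npair i (seq_code [:: val b]))).
  exact: computes_pair (computes_const _ _)
    (computes_pair (computes_id _) (computes_const _ _)).
exists (Comp Oracle q) => i; rewrite hX.
by split=> h; eexists; [exact: hq|left|exact: hq|right].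
Qed.
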